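(* Let $r\ge 2$, let $F\in\mathcal{H}_{0}$, and let $H\in\mathcal{H}_{0}$ satisfy $\inf_{x\in S^{1}}|H(x)-F(x)|=\sigma>0$. For $\lambda\in\mathbb{R}$ put $\alpha_{\lambda}(x)=F(x)+\lambda\,(H(x)-F(x))$. Let $n\in\mathbb{N}$ and $\gamma>0$, and let $m$ be Lebesgue measure on $\mathbb{R}$. Let $$Z_{\gamma}^{n}(F)=\{\lambda\in\mathbb{R} \mid \alpha_{\lambda}\in\mathcal{H}_{0}\text{ and there is } x\in E_{\gamma}^{n}(\alpha_{\lambda})\},$$ equivalently the set of values $\lambda(x)=\Delta_n(x)$ with $x\in E^n_\gamma(\alpha_\lambda)$ and $\alpha_\lambda\in\mathcal{H}_0$. Then $$m(Z_{\gamma}^{n}(F))\le c_{n}\,\frac{\gamma}{\sigma}$$ for some positive constant $c_{n}$ that depends on $\min\{\alpha_{\lambda}'(x) \mid x\in\bigcup E_{\gamma}^{n}(\alpha_{\lambda})\}$, where the union is over the $\lambda$ with $\alpha_\lambda\in\mathcal{H}_0$ and, at each such $x$, $\lambda=\Delta_n(x)$.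
   Context: $S^{1}=\mathbb{R}/\mathbb{Z}$. $\mathcal{H}_{0}$ is the set of liftings to $\mathbb{R}$ of order preserving $C^{r}$ diffeomorphisms of $S^{1}$, that is, the set of $C^{r}$ diffeomorphisms $F:\mathbb{R}\to\mathbb{R}$ with $F'>0$ and $F(x+1)=F(x)+1$ for all $x$. For two liftings $F,H$ the function $H-F$ is $1$-periodic, hence is regarded as a function on $S^{1}$. For a lifting $A$, the symbol $A^{n}$ denotes the $n$-th iterate, and $$E_{\gamma}^{n}(A)=\{x\in S^{1} \mid A^{n}(x)=x,\ |(A^{n})'(x)-1|\le\gamma\},$$ where $A^{n}(x)=x$ is an equation for the lifting (this condition and $(A^n)'$ are $1$-periodic in $x$, so the set is well defined in $S^1$). The $n$-evaluation map associated with the path $\alpha_\lambda$ is the (possibly multivalued, possibly empty) $1$-periodic map $\Delta_{n}(x)=\{\lambda \mid \alpha_{\lambda}^{n}(x)=x\}$, and $\lambda(x)$ denotes $\Delta_{n}(x)$. When restricted to those $\lambda$ for which $\alpha_\lambda\in\mathcal{H}_0$ it is single-valued. *)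

(* Defs.v *)
From HB Require Import structures.
From mathcomp Require Export all_boot all_order all_algebra.
From mathcomp Require Export all_classical all_reals all_analysis.
Export Order.TTheory GRing.Theory Num.Theory.
Export numFieldNormedType.Exports.

Set Implicit Arguments.
Unset Strict Implicit.
Unset Printing Implicit Defensive.

Local Open Scope ring_scope.
Local Open Scope classical_set_scope.

(* The circle S^1 = R/Z is handled through its universal cover: a subset of
   S^1 is represented by its 1-periodic preimage in R, and a function on S^1 by
   its 1-periodic lift. Quantifying, or taking an infimum, over x in S^1 is then
   the same as over x in R. *)

Definition class_C (R : realType) (r : nat) (f : R -> R) : Prop :=
  (forall (k : nat) (x : R), (k < r)%N -> derivable f^`(k) x 1) /\
  continuous f^`(r).

Definition diffeo_C (R : realType) (r : nat) (f : R -> R) : Prop :=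
  class_C r f /\
  exists g : R -> R, [/\ class_C r g, cancel f g & cancel g f].

(* The set H_0 in class C^r. *)
Definition liftings (R : realType) (r : nat) : set (R -> R) :=
  [set A | [/\ diffeo_C r A,
               forall x, 0 < A^`() x &
               forall x, A (x + 1) = A x + 1]].

Definition path_lift (R : realType) (F H : R -> R) (lam : R) : R -> R :=
  fun x => F x + lam * (H x - F x).

(* The lift to R of E_gamma^n(A). *)
Definition Eset (R : realType) (n : nat) (gamma : R) (A : R -> R) : set R :=
  [set x | iter n A x = x /\ `|derive1 (iter n A) x - 1| <= gamma].

(* The multivalued n-evaluation map Delta_n of the path. *)
Definition evaluation (R : realType) (F H : R -> R) (n : nat) (x : R) : set R :=
  [set lam | iter n (path_lift F H lam) x = x].

Definition Zset (R : realType) (r : nat) (F H : R -> R) (n : nat) (gamma : R) :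
    set R :=
  [set lam | liftings r (path_lift F H lam) /\
             exists x, Eset n gamma (path_lift F H lam) x].

(* The slopes alpha_lam'(x), over all lam with alpha_lam in H_0 and all x in
   E_gamma^n(alpha_lam), where lam = Delta_n(x). *)
Definition slopes (R : realType) (r : nat) (F H : R -> R) (n : nat)
    (gamma : R) : set R :=
  [set s | exists lam x,
     [/\ liftings r (path_lift F H lam),
         Eset n gamma (path_lift F H lam) x,
         evaluation F H n x lam &
         s = (path_lift F H lam)^`() x]].

(* The minimum of the slopes, as an infimum: the parameters lam with alpha_lam
   in H_0 form an open set, so the minimum need not be attained. It is the
   minimum whenever that exists. The slopes are bounded below by 0; when there
   are none, so that Zset is empty too, inf returns 0. *)
Definition min_slope (R : realType) (r : nat) (F H : R -> R) (n : nat)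
    (gamma : R) : R :=
  inf (slopes r F H n gamma).

(* Main.v *)
(** Write [alpha_l] for [path_lift F H l] and [A^n] for iterates. Since
    [|H - F| >= sigma] has constant sign, [alpha_l^n(y)] is monotone in [l] with
    slope at least [sigma], already because of the last of the [n] applications.
    If [x] and [y] are fixed by [alpha_l^n] and [alpha_m^n] respectively, this
    gives
      [sigma |l - m| <= |alpha_l^n(y) - y| = |(alpha_l^n)'(c) - 1| |y - x|]
    for some [c] between [x] and [y]. Parameters admitting a periodic point are
    bounded, so the derivatives [(alpha_l^n)'] are uniformly Lipschitz, and the
    right-hand side is at most [2 gamma |y - x|] when [x] lies in
    [E_gamma^n(alpha_l)] and [y] is close to [x]. Cutting [0, 1] into [N] equal
    pieces covers the set of parameters by [N] sets of diameter
    [2 gamma / (sigma N)], each inside an interval of twice that length, whence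
    the constant [4]. *)

From mathcomp Require Import lra ring.
Require Import Defs.

Set Implicit Arguments.
Unset Strict Implicit.
Unset Printing Implicit Defensive.

Local Open Scope ring_scope.
Local Open Scope classical_set_scope.

(** * Mean value estimates and comparison of iterates *)

Lemma derivable_MVT (R : realType) (f : R -> R) (x y : R) :
  (forall z, derivable f z 1) ->
  exists2 c, `|c - x| <= `|y - x| & f y - f x = derive1 f c * (y - x).
Proof.
move=> df.
have cf : continuous f.
  by move=> z; apply: differentiable_continuous; apply/derivable1_diffP.
have idf (z : R) : is_derive z 1 f (derive1 f z).
  by rewrite derive1E; exact: derivableP.
have [xy|/ltW yx] := leP x y.
- have [] := @MVT_segment R f (derive1 f) x y xy (fun z _ => idf z).
    exact: continuous_subspaceT.
  move=> c; rewrite in_itv /= => /andP[xc cy] e; exists c => //.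
  by rewrite !ger0_norm ?subr_ge0// lerD2r.
- have [] := @MVT_segment R f (derive1 f) y x yx (fun z _ => idf z).
    exact: continuous_subspaceT.
  move=> c; rewrite in_itv /= => /andP[yc cx] e; exists c.
    by rewrite !ler0_norm ?subr_le0// lerN2 lerD2r.
  by rewrite -[LHS]opprB e -mulrN opprB.
Qed.

Lemma derive1_bounded_lipschitz (R : realType) (f : R -> R) (M : R) :
  (forall z, derivable f z 1) -> (forall z, `|derive1 f z| <= M) ->
  forall x y, `|f y - f x| <= M * `|y - x|.
Proof.
move=> df fM x y; have [c _ ->] := derivable_MVT x y df.
by rewrite normrM ler_wpM2r.
Qed.

(** The outermost application alone produces the gap [c]. The inner iterates are only compared in
    order, and the monotonicity of [b] carries that order through. *)
Lemma iter_gap (R : realType) (a b : R -> R) (c : R) (n : nat) (x : R) :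
  0 <= c -> {homo b : u v / u <= v} -> (forall u, a u + c <= b u) ->
  iter n.+1 a x + c <= iter n.+1 b x.
Proof.
move=> c0 bm ab; elim: n => [|n IH] /=; first exact: ab.
apply: le_trans (ab _) _; apply: bm.
by apply: le_trans IH; rewrite lerDl.
Qed.

(** * Integer translations and periodic functions *)

Lemma shift_int (R : realType) (f : R -> R) (c : R) (k : int) (x : R) :
  (forall u, f (u + 1) = f u + c) -> f (x + k%:~R) = f x + c *~ k.
Proof.
move=> f1.
have fn (m : nat) u : f (u + m%:R) = f u + c *+ m.
  elim: m => [|m IH]; first by rewrite !addr0.
  by rewrite -addn1 natrD addrA f1 IH mulrnDr addrA.
case: k => m; first exact: fn.
rewrite NegzE rmorphN mulrNz /=.
by rewrite -[in RHS](subrK m.+1%:~R x) fn addrK.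
Qed.

Lemma iter_shift_int (R : realType) (A : R -> R) (n : nat) (k : int) (x : R) :
  (forall u, A (u + 1) = A u + 1) ->
  iter n A (x + k%:~R) = iter n A x + k%:~R.
Proof. by move=> A1; elim: n => //= n ->; exact: shift_int. Qed.

Lemma derive1_shift (R : realType) (f : R -> R) (k c : R) :
  (forall x, f (x + k) = f x + c) -> forall x, derive1 f (x + k) = derive1 f x.
Proof.
move=> fk x; rewrite /derive1.
suff -> : (fun h => h^-1 *: (f (h + (x + k)) - f (x + k))) =
          (fun h => h^-1 *: (f (h + x) - f x)) by [].
by apply/funext => h; rewrite addrA !fk opprD addrACA subrr addr0.
Qed.

Lemma periodic_continuous_bounded (R : realType) (f : R -> R) :
  continuous f -> (forall x, f (x + 1) = f x) ->
  exists2 M, 0 <= M & forall x, `|f x| <= M.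
Proof.
move=> cf f1.
have fk (k : int) x : f (x + k%:~R) = f x.
  by rewrite (@shift_int _ _ 0) ?mul0rz ?addr0// => u; rewrite f1 addr0.
have cn : {within `[0 : R, 1], continuous (fun x => `|f x|)}.
  apply: continuous_subspaceT => x.
  by apply: (@continuous_comp _ _ _ f Num.norm x (cf x)); exact: norm_continuous.
have [c _ cM] := EVT_max ler01 cn.
exists `|f c| => // x.
rewrite -(subrK (Num.floor x)%:~R x) fk.
apply: cM; rewrite in_itv /=.
have /andP[fx xf] := floor_itv x.
rewrite subr_ge0 fx /= lerBlDr; apply/ltW.
by rewrite intrD addrC in xf.
Qed.

(** * Lipschitz derivatives of iterates, uniformly in the map *)

Lemma iter_derive1_lipschitz (R : realType) (M L : R) (n : nat) :
  0 <= M -> 0 <= L ->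
  exists2 Q, 0 <= Q & forall A : R -> R,
    (forall x, derivable A x 1) -> (forall x, `|derive1 A x| <= M) ->
    (forall x y, `|derive1 A y - derive1 A x| <= L * `|y - x|) ->
    (forall x, derivable (iter n A) x 1) /\
    forall x y, `|derive1 (iter n A) y - derive1 (iter n A) x| <= Q * `|y - x|.
Proof.
move=> M0 L0.
(* The induction also carries the bound [M ^+ n] on the derivative of the iterate. [Q] is chosen
   before [A], so one [Q] will serve all parameters of the path. *)
suff [Q Q0 H] : exists2 Q, 0 <= Q & forall A : R -> R,
    (forall x, derivable A x 1) -> (forall x, `|derive1 A x| <= M) ->
    (forall x y, `|derive1 A y - derive1 A x| <= L * `|y - x|) ->
    [/\ (forall x, derivable (iter n A) x 1),
    (forall x, `|derive1 (iter n A) x| <= M ^+ n) &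
    forall x y, `|derive1 (iter n A) y - derive1 (iter n A) x| <= Q * `|y - x|].
  by exists Q => // A h1 h2 h3; have [] := H A h1 h2 h3.
elim: n => [|n [Q Q0 IH]].
  exists 0 => // A _ _ _.
  have e x : derive1 (iter 0 A) x = 1 by rewrite derive1E /=; exact: derive_id.
  split=> [x|x|x y]; first exact: derivable_id.
    by rewrite e normr1.
  by rewrite !e subrr normr0 mul0r.
(* By the chain rule the derivative is a product. Its first factor varies by at most
   [L * M ^+ n * |y - x|] and is multiplied by at most [M ^+ n]; its second varies by at most
   [Q * |y - x|] and is multiplied by at most [M]. *)
exists (L * M ^+ n * M ^+ n + M * Q).
  by rewrite addr_ge0 ?mulr_ge0 ?exprn_ge0.
move=> A dA AM AL; have [dn nM nL] := IH A dA AM AL.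
have dS x : derivable (iter n.+1 A) x 1.
  have h1 := derivableP (dA (iter n A x)); have h2 := derivableP (dn x).
  have h := is_derive1_comp h1 h2; exact: (@ex_derive _ _ _ _ _ _ _ h).
have e x :
    derive1 (iter n.+1 A) x = derive1 A (iter n A x) * derive1 (iter n A) x.
  exact: (derive1_comp (dn x) (dA _)).
split => // [x|x y]; first by rewrite e normrM exprS ler_pM.
rewrite !e.
set u := iter n A y; set v := iter n A x.
set p := derive1 (iter n A) y; set q := derive1 (iter n A) x.
have -> : derive1 A u * p - derive1 A v * q =
    (derive1 A u - derive1 A v) * p + derive1 A v * (p - q).
  by ring.
apply: (le_trans (ler_normD _ _)); rewrite [leRHS]mulrDl !normrM; apply: lerD.
  apply: (@le_trans _ _ (L * (M ^+ n * `|y - x|) * M ^+ n)).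
    apply: ler_pM => //; last exact: nM.
    apply: (le_trans (AL _ _)); rewrite ler_wpM2l//.
    exact: derive1_bounded_lipschitz dn nM x y.
  by rewrite le_eqVlt; apply/orP; left; apply/eqP; ring.
by rewrite -mulrA ler_pM //; exact: nL.
Qed.

(** * Small covers and constant sign *)

Lemma lebesgue_measure_small_cover (R : realType) (Z : set R)
    (A : nat -> set R) (N : nat) (d : R) :
  0 <= d -> (forall i x y, A i x -> A i y -> `|x - y| <= d) ->
  Z `<=` \bigcup_(i < N) A i ->
  (lebesgue_measure Z <= ((d *+ 2) *+ N)%:E)%E.
Proof.
move=> d0 Ad ZA.
(* Any point of a nonempty piece serves as centre, at the price of length [2 d] instead of [d]. *)
have /choice[z Az] : forall i, exists z, A i `<=` `[z - d, z + d].
  move=> i; have [->|/set0P[z Aiz]] := eqVneq (A i) set0; first by exists 0.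
  exists z => y Aiy; rewrite /= in_itv /= -ler_distlC.
  exact: Ad Aiz Aiy.
pose B i : set R := `[z i - d, z i + d].
apply: (@le_trans _ _ (lebesgue_measure (\bigcup_(i < N) B i))).
  (* [Z] need not be measurable: as a total function, [lebesgue_measure] is the
     Lebesgue outer measure. *)
  by apply: le_mu_ext => x /ZA[i iN Aix]; exists i => //; exact: Az.
rewrite bigcup_mkord; apply: le_trans.
  apply: Boole_inequality => i _; exact: measurable_itv.
rewrite -[X in (_ <= (_ *+ X)%:E)%E]card_ord -sumr_const -sumEFin.
apply: lee_sum => i _; rewrite /= lebesgue_measure_itv /= lte_fin.
case: ifP => _; last by rewrite lee_fin mulrn_wge0.
by rewrite -EFinD lee_fin opprB addrC subrKA mulr2n.
Qed.

(** A change of sign would give a zero by the intermediate value theorem. *)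
Lemma norm_ge_constant_sign (R : realType) (f : R -> R) (s : R) :
  continuous f -> 0 < s -> (forall x, s <= `|f x|) ->
  (forall x, s <= f x) \/ (forall x, f x <= - s).
Proof.
move=> cf s0 fs.
have nz x : f x != 0 by rewrite -normr_gt0; apply: lt_le_trans (fs x).
have nochange x y : f x < 0 -> 0 < f y -> False.
  move=> fx fy; have [xy|/ltW yx] := leP x y.
  - have [||c _ c0] := @IVT R f x y 0 xy.
    + exact: continuous_subspaceT.
    + by rewrite ge_min le_max (ltW fx) (ltW fy) orbT.
    + by move: (nz c); rewrite c0 eqxx.
  - have [||c _ c0] := @IVT R f y x 0 yx.
    + exact: continuous_subspaceT.
    + by rewrite ge_min le_max (ltW fx) (ltW fy) orbT.
    + by move: (nz c); rewrite c0 eqxx.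
have [f0|f0] := ltP (f 0) 0; [right|left] => x; have := fs x.
- have [fx|fx] := ltP (f x) 0; first by rewrite ltr0_norm// lerNr.
  by exfalso; apply: (nochange 0 x f0); rewrite lt_neqAle eq_sym nz fx.
- have [fx|fx] := ltP (f x) 0; last by rewrite ger0_norm.
  by exfalso; apply: (nochange x 0 fx); rewrite lt_neqAle eq_sym nz f0.
Qed.

(** * Regularity and bounds of liftings *)

Lemma lifting_continuous_derivatives (R : realType) (r : nat) (F : R -> R) :
  (2 <= r)%N -> liftings r F ->
  [/\ forall x, derivable F x 1, forall x, derivable (derive1 F) x 1 &
      continuous (derive1 (derive1 F))].
Proof.
move=> r2 [[[dF cF] _] _ _]; split.
- by move=> x; apply: (dF 0%N); apply: leq_trans r2.
- by move=> x; apply: (dF 1%N).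
(* For [r > 2] the second derivative is continuous because it is derivable; for [r = 2] its
   continuity is the last clause of [class_C]. *)
- case: (ltngtP 2 r) r2 => // [r2 _|e _].
    move=> x; apply: differentiable_continuous; apply/derivable1_diffP.
    exact: (dF 2%N).
  by move: cF; rewrite -e.
Qed.

Lemma lifting_nondecreasing (R : realType) (r : nat) (F : R -> R) :
  (2 <= r)%N -> liftings r F -> {homo F : x y / x <= y}.
Proof.
move=> r2 hF x y xy.
have [dF _ _] := lifting_continuous_derivatives r2 hF.
have [_ F0 _] := hF.
have [c _ e] := derivable_MVT x y dF.
by rewrite -subr_ge0 e mulr_ge0 ?subr_ge0 ?(ltW (F0 _)).
Qed.

(** The displacement [F x - x] and the first two derivatives of [F] are continuous and 1-periodic,
    hence bounded; the bound on the second derivative is the Lipschitz constant of the first. *)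
Lemma lifting_bounds (R : realType) (r : nat) (F : R -> R) :
  (2 <= r)%N -> liftings r F ->
  exists2 B, 0 <= B &
    [/\ forall x, `|F x - x| <= B, forall x, `|derive1 F x| <= B &
        forall x y, `|derive1 F y - derive1 F x| <= B * `|y - x|].
Proof.
move=> r2 hF; have [dF d2F cF2] := lifting_continuous_derivatives r2 hF.
have [_ _ F1] := hF.
have cF : continuous F.
  by move=> z; apply: differentiable_continuous; apply/derivable1_diffP.
have cF1 : continuous (derive1 F).
  by move=> z; apply: differentiable_continuous; apply/derivable1_diffP.
have pF1 := derive1_shift F1.
have pF2 : forall x, derive1 (derive1 F) (x + 1) = derive1 (derive1 F) x.
  by apply: (@derive1_shift _ _ _ 0) => x; rewrite addr0 pF1.
have [|x|B0 B00 b0] := @periodic_continuous_bounded _ (fun x => F x - x).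
- by move=> x; apply: cvgB; [exact: cF|exact: cvg_id].
- by rewrite F1 opprD addrACA subrr addr0.
have [B1 B10 b1] := periodic_continuous_bounded cF1 pF1.
have [B2 B20 b2] := periodic_continuous_bounded cF2 pF2.
exists (B0 + B1 + B2); first by rewrite !addr_ge0.
split=> [x|x|x y].
- by apply: le_trans (b0 x) _; lra.
- by apply: le_trans (b1 x) _; lra.
- apply: le_trans (derive1_bounded_lipschitz d2F b2 x y) _.
  by apply: ler_wpM2r => //; lra.
Qed.

(** * Dependence of the path on its parameter *)

Lemma path_iter_gap (R : realType) (F H : R -> R) (s l m y : R) (n : nat) :
  0 <= s ->
  (forall x, s <= H x - F x) \/ (forall x, H x - F x <= - s) ->
  {homo path_lift F H l : u v / u <= v} ->
  {homo path_lift F H m : u v / u <= v} ->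
  s * `|l - m| <=
    `|iter n.+1 (path_lift F H l) y - iter n.+1 (path_lift F H m) y|.
Proof.
move=> s0 sgn; wlog lm : l m / l <= m => [W hl hm|hl hm].
  have [/W|/ltW/W] := leP l m; first exact.
  by rewrite distrC [leRHS]distrC; exact.
have c0 : 0 <= s * (m - l) by rewrite mulr_ge0// subr_ge0.
have -> : `|l - m| = m - l by rewrite distrC ger0_norm// subr_ge0.
(* The sign of [H - F] decides which of the two maps lies above the other, by at least
   [s * (m - l)]. *)
case: sgn => sgn.
- have := @iter_gap R (path_lift F H l) (path_lift F H m) _ n y c0 hm.
  rewrite distrC => h; apply: le_trans (ler_norm _).
  rewrite lerBrDl; apply: h => u.
  by rewrite /path_lift; have := sgn u; nra.
- have := @iter_gap R (path_lift F H m) (path_lift F H l) _ n y c0 hl.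
  move=> h; apply: le_trans (ler_norm _).
  rewrite lerBrDl; apply: h => u.
  by rewrite /path_lift; have := sgn u; nra.
Qed.

(** If [s * |l| > K], the term [l * (H - F)] outweighs the displacement of [F], so every point moves
    in one and the same direction by at least [s * |l| - K]. Comparison with the identity then
    excludes periodic points. *)
Lemma path_periodic_parameter_bound (R : realType) (F H : R -> R)
    (s K l x : R) (n : nat) :
  0 <= s ->
  (forall x, s <= H x - F x) \/ (forall x, H x - F x <= - s) ->
  (forall u, `|F u - u| <= K) ->
  {homo path_lift F H l : u v / u <= v} ->
  iter n.+1 (path_lift F H l) x = x -> s * `|l| <= K.
Proof.
move=> s0 sgn FK hl fx; rewrite leNgt; apply/negP => lt.
have iid k : iter k id x = x by elim: k.
have c0 : 0 <= s * `|l| - K by rewrite subr_ge0 ltW.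
have [up|down] : (forall u, u + (s * `|l| - K) <= path_lift F H l u) \/
    (forall u, path_lift F H l u + (s * `|l| - K) <= u).
- rewrite /path_lift; have [l0|l0] := leP 0 l.
    rewrite ger0_norm//; case: sgn => sgn; [left|right] => u;
      have := sgn u; have := FK u; rewrite ler_norml => /andP[]; nra.
  rewrite ltr0_norm//; case: sgn => sgn; [right|left] => u;
    have := sgn u; have := FK u; rewrite ler_norml => /andP[]; nra.
- have := @iter_gap R id (path_lift F H l) _ n x c0 hl up.
  by rewrite fx iid; lra.
- have := @iter_gap R (path_lift F H l) id _ n x c0 (fun _ _ => id) down.
  by rewrite fx iid; lra.
Qed.

Lemma Eset_shift_int (R : realType) (n : nat) (gamma : R) (A : R -> R)
    (k : int) (x : R) :
  (forall u, A (u + 1) = A u + 1) ->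
  Eset n gamma A x -> Eset n gamma A (x + k%:~R).
Proof.
move=> A1 [fx dx].
have s u := @iter_shift_int R A n k u A1.
by split; [rewrite s fx|rewrite (derive1_shift s)].
Qed.

Theorem theorem15 (R : realType) :
  exists c : nat -> R -> R,
    (forall (n : nat) (mu : R), 0 < c n mu) /\
    forall (r : nat) (F H : R -> R) (sigma : R) (n : nat) (gamma : R),
      (2 <= r)%N ->
      liftings r F ->
      liftings r H ->
      inf (range (fun x : R => `|H x - F x|)) = sigma ->
      0 < sigma ->
      (0 < n)%N ->
      0 < gamma ->
      (lebesgue_measure (Zset r F H n gamma) <=
        (c n (min_slope r F H n gamma) * (gamma / sigma))%:E)%E.
Proof.
(* One factor 2 comes from the bound [2 * g] on the derivative minus 1, the other from enclosing
   each piece in an interval. *)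
exists (fun _ _ => 4); split=> [_ _|r F H s n g r2 hF hH Es s0 n0 g0] //.
have [B B0 [FB F1B F2B]] := lifting_bounds r2 hF.
have [C C0 [_ H1C H2C]] := lifting_bounds r2 hH.
have [dF _ _] := lifting_continuous_derivatives r2 hF.
have [dH _ _] := lifting_continuous_derivatives r2 hH.
have sgn : (forall x, s <= H x - F x) \/ (forall x, H x - F x <= - s).
  apply: norm_ge_constant_sign => // x.
    by apply: cvgB; apply: differentiable_continuous; apply/derivable1_diffP.
  rewrite -Es; apply: ge_inf; last by exists x.
  by exists 0 => _ [y _ <-].
have dpath l x : derivable (path_lift F H l) x 1.
  apply: derivableD => //.
  by apply: (@derivableZ _ _ _ (H - F)); exact: derivableB.
have path1 l x :
    derive1 (path_lift F H l) x = derive1 F x + l * (derive1 H x - derive1 F x).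
  rewrite !derive1E deriveD//; last first.
    by apply: (@derivableZ _ _ _ (H - F)); exact: derivableB.
  rewrite (@deriveZ _ _ _ (H - F)); last exact: derivableB.
  by rewrite deriveB.
(* [L] bounds the parameters that admit a periodic point. For these, [M] bounds both the derivative
   of the path map and its Lipschitz constant. *)
pose L := B / s.
pose M := B + L * (C + B).
have L0 : 0 <= L by rewrite divr_ge0// ltW.
have M0 : 0 <= M by rewrite addr_ge0// mulr_ge0// addr_ge0.
have path1M l x : `|l| <= L -> `|derive1 (path_lift F H l) x| <= M.
  move=> lL; rewrite path1; apply: le_trans (ler_normD _ _) _.
  rewrite lerD// normrM ler_pM//.
  by apply: le_trans (ler_normB _ _) _; rewrite lerD.
have path1L l x y : `|l| <= L ->
    `|derive1 (path_lift F H l) y - derive1 (path_lift F H l) x| <= M * `|y - x|.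
  move=> lL; rewrite !path1.
  rewrite (_ : _ - _ = (derive1 F y - derive1 F x) +
    l * ((derive1 H y - derive1 H x) - (derive1 F y - derive1 F x))); last by ring.
  apply: le_trans (ler_normD _ _) _; rewrite [leRHS]mulrDl lerD//.
  rewrite normrM -mulrA ler_pM//.
  by apply: le_trans (ler_normB _ _) _; rewrite mulrDl lerD.
have [Q Q0 iterQ] := iter_derive1_lipschitz n M0 M0.
(* So many pieces that the derivative of the iterate varies by at most [g] over a length [1 / N]. *)
pose N := (Num.truncn (Q / g)).+1.
have N0 : 0 < N%:R :> R by rewrite ltr0n.
have QN : Q / N%:R <= g.
  rewrite ler_pdivrMr// mulrC -ler_pdivrMr//.
  by have /andP[_ /ltW] := truncn_itv (divr_ge0 Q0 (ltW g0)).
pose A (i : nat) : set R := [set l | liftings r (path_lift F H l) /\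
  exists2 x, Eset n g (path_lift F H l) x & i%:R / N%:R <= x <= i.+1%:R / N%:R].
pose d := 2 * g / s / N%:R.
have -> : 4 * (g / s) = d *+ 2 *+ N.
  by rewrite -mulr_natr -[d *+ 2]mulr_natr /d; field; rewrite ?gt_eqF.
apply: (@lebesgue_measure_small_cover R _ A N d).
- by rewrite !divr_ge0// ?mulr_ge0// ltW.
- move=> i l m [hl [x [fx dx] /andP[ix xi]]] [hm [y [fy _] /andP[iy yi]]].
  have ml := lifting_nondecreasing r2 hl; have mm := lifting_nondecreasing r2 hm.
  (* The gap estimates concern at least one application, hence the form [n.+1]. *)
  case: n n0 iterQ fx dx fy @A => // n _ iterQ fx dx fy A.
  have lL : `|l| <= L.
    rewrite ler_pdivlMr// mulrC.
    exact: path_periodic_parameter_bound (ltW s0) sgn FB ml fx.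
  have [dn nQ] := iterQ _ (dpath l) (fun z => path1M l z lL)
    (fun z w => path1L l z w lL).
  have gap := path_iter_gap y n (ltW s0) sgn ml mm.
  have yx : `|y - x| <= N%:R^-1.
    have e : i.+1%:R / N%:R = i%:R / N%:R + N%:R^-1 :> R.
      by rewrite -natr1 mulrDl mul1r.
    by rewrite ler_norml; move: xi yi; rewrite !e => xi yi; apply/andP; split; lra.
  have [c cx e] := derivable_MVT x y dn.
  rewrite fy in gap; rewrite fx in e.
  rewrite -(ler_pM2l s0); apply: le_trans gap _.
  have -> : s * d = 2 * g * N%:R^-1.
    by rewrite /d; field; rewrite ?gt_eqF.
  have -> : iter n.+1 (path_lift F H l) y - y =
      (derive1 (iter n.+1 (path_lift F H l)) c - 1) * (y - x).
    by rewrite mulrBl mul1r -e; ring.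
  rewrite normrM ler_pM//.
  (* Passing through the derivative at [x]: it is within [g] of 1, and moving from [x] to [c] costs
     at most [Q / N <= g]. *)
  rewrite -(subrK (derive1 (iter n.+1 (path_lift F H l)) x)
    (derive1 (iter n.+1 (path_lift F H l)) c)) -addrA.
  apply: le_trans (ler_normD _ _) _.
  have -> : 2 * g = g + g by ring.
  apply: lerD => //; apply: le_trans (nQ _ _) _; apply: le_trans QN.
  by rewrite ler_wpM2l// (le_trans cx).
(* The periodic point is replaced by its fractional part [z]; as [z < 1], the index
   [Num.truncn (z * N)] is below [N]. *)
- move=> l [hl [x Ex]]; have [_ _ l1] := hl.
  have {Ex} := Eset_shift_int (- Num.floor x) l1 Ex.
  have := floor_itv x; rewrite intrN intrD; set z := x - _ => /andP[zl zr] Ez.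
  have z0 : 0 <= z by rewrite subr_ge0.
  have z1 : z < 1 by rewrite ltrBlDl.
  have zN0 : 0 <= z * N%:R by rewrite mulr_ge0// ltW.
  have /andP[tl tr] := truncn_itv zN0.
  exists (Num.truncn (z * N%:R)).
    by rewrite /= -(ltr_nat R); apply: le_lt_trans tl _; rewrite gtr_pMl.
  split=> //; exists z => //; apply/andP; split.
    by rewrite ler_pdivrMr.
  by rewrite ler_pdivlMr// ltW.
Qed.
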